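(* Let $\lambda\approx 0.6903845$ be the unique positive real root of the polynomial $176x^4-200x^3+47x^2+18x-9$. Then $$a_2(K_{3,3})\ge 2(1-\lambda)\approx 0.6192309.$$
   Context: $K_{3,3}$ is the complete bipartite graph with both sides of size $3$. For a finite simple graph $G=(V,E)$ with $|V|\ge 3$ and $p:V\to\mathbb{R}^2$, for $u,v\in V$ put $d_{uv}=\frac{p(u)-p(v)}{\|p(u)-p(v)\|}$ if $p(u)\neq p(v)$ and $d_{uv}=0$ otherwise. The rigidity matrix $R(G,p)\in\mathbb{R}^{2|V|\times|E|}$ has rows indexed by pairs $(u,i)$, $u\in V$, $i\in\{1,2\}$, columns indexed by edges, and entries $R(G,p)_{(u,i),e}=(d_{uv})_i$ if $e=\{u,v\}$ for some $v\in V$, and $0$ if $u\notin e$. The stiffness matrix is $L(G,p)=R(G,p)R(G,p)^{\top}$. Let $\lambda_k(M)$ denote the $k$-th smallest eigenvalue (with multiplicity) of a symmetric matrix $M$. The $2$-dimensional algebraic connectivity of $G$ is $$a_2(G)=\sup\left\{\lambda_{4}(L(G,p))\ :\ p:V\to\mathbb{R}^2\right\}.$$ *)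

(* Defs.v *)
From HB Require Import structures.
From mathcomp Require Import all_boot all_order all_algebra.
From mathcomp Require Import polyorder polyrcf.
From mathcomp Require Import boolp classical_sets reals.

Set Implicit Arguments.
Unset Strict Implicit.
Unset Printing Implicit Defensive.

Import Order.TTheory GRing.Theory Num.Theory.

Local Open Scope ring_scope.
Local Open Scope classical_set_scope.

Record simple_graph := SimpleGraph {
  vertex : finType;
  adj : rel vertex;
  adj_sym : symmetric adj;
  adj_irr : irreflexive adj }.

Definition edges (G : simple_graph) : {set {set vertex G}} :=
  [set [set uv.1; uv.2] | uv : vertex G * vertex G & adj uv.1 uv.2]%SET.

Definition opposite_sides (m n : nat) : rel ('I_m + 'I_n)%type :=
  fun x y => match x, y with
             | inl _, inr _ | inr _, inl _ => true
             | _, _ => false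
             end.

Lemma opposite_sides_sym m n : symmetric (@opposite_sides m n).
Proof. by move=> [x|x] [y|y]. Qed.

Lemma opposite_sides_irr m n : irreflexive (@opposite_sides m n).
Proof. by move=> [x|x]. Qed.

Definition complete_bipartite (m n : nat) : simple_graph :=
  SimpleGraph (@opposite_sides_sym m n) (@opposite_sides_irr m n).

Section Eigenvalues.
Variables (R : realType) (n : nat).
Implicit Type M : 'M[R]_n.

(* [rootsR] is strictly increasing and without multiplicities, so each root of
   the characteristic polynomial is repeated according to its multiplicity.
   When M is symmetric all n eigenvalues are real and this list has size n. *)
Definition eigenvalues M : seq R :=
  flatten [seq nseq (\mu_x (char_poly M)) x | x <- rootsR (char_poly M)].

(* Counted from k = 1; the default value 0 is only reached when k exceeds the
   number of real eigenvalues. *)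
Definition kth_eigenvalue (k : nat) M : R := nth 0 (eigenvalues M) k.-1.

Lemma mem_eigenvalues M x : (x \in eigenvalues M) = eigenvalue M x.
Proof.
have p0 : char_poly M != 0 by rewrite monic_neq0 ?char_poly_monic.
rewrite eigenvalue_root_char; apply/flatten_mapP/idP => [[y _]|rx].
  by rewrite mem_nseq => /andP[+ /eqP->]; rewrite mu_gt0.
exists x; last by rewrite mem_nseq eqxx mu_gt0 ?rx.
by rewrite -(roots_on_rootsR p0) inE /= rx.
Qed.

Lemma sorted_eigenvalues M : sorted <=%R (eigenvalues M).
Proof.
rewrite /eigenvalues.
have : sorted <%R (rootsR (char_poly M)) by exact: sorted_roots.
rewrite !(sorted_pairwise lt_trans) (sorted_pairwise le_trans).
elim: (rootsR _) => //= x s IH /andP[/allP xs /IH {}IH].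
rewrite pairwise_cat {}IH andbT; apply/andP; split; last first.
  by elim: (\mu_x _) => //= k ->; rewrite andbT; apply/allP => y /nseqP[->].
apply/allrelP => y z /nseqP[-> _] /flatten_mapP[t /xs xt /nseqP[-> _]].
exact: ltW.
Qed.

End Eigenvalues.

Section Rigidity.
Variables (R : realType) (G : simple_graph).
Implicit Types (p : vertex G -> 'rV[R]_2).

(* The library's norm on 'rV[R]_2 is the sup norm, not the Euclidean one. *)
Definition euclidean_norm (x : 'rV[R]_2) : R :=
  Num.sqrt (\sum_(i < 2) x 0 i ^+ 2).

Definition direction p (u v : vertex G) : 'rV[R]_2 :=
  if p u != p v then (euclidean_norm (p u - p v))^-1 *: (p u - p v) else 0.

(* Rows and columns are numbered by the library enumerations of
   vertex G * 'I_2 and of the edge set.  The [pick] returns the other end of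
   the edge, and None exactly when u is not on the edge. *)
Definition rigidity_matrix p :
    'M[R]_(#|{: vertex G * 'I_2}|, #|edges G|) :=
  \matrix_(r, c)
    let: (u, i) := enum_val r in
    if [pick v | (enum_val c : {set vertex G}) == [set u; v]%SET] is Some v
    then direction p u v 0 i else 0.

Definition stiffness_matrix p : 'M[R]_#|{: vertex G * 'I_2}| :=
  rigidity_matrix p *m (rigidity_matrix p)^T.

End Rigidity.

(* The set is bounded above, since each entry of the stiffness matrix is at
   most #|vertex G| in absolute value.  For #|vertex G| >= 3 the matrix has
   order at least 6, so that its fourth eigenvalue exists. *)
Definition algebraic_connectivity2 (R : realType) (G : simple_graph) : R :=
  sup [set kth_eigenvalue 4 (stiffness_matrix p) |
        p in [set: vertex G -> 'rV[R]_2]].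

Definition lambda_poly (R : realType) : {poly R} :=
  176 *: 'X^4 - 200 *: 'X^3 + 47 *: 'X^2 + 18 *: 'X - 9%:P.

(* Main.v *)
Require Import Defs.
From mathcomp Require Import all_boot all_order all_algebra.
From mathcomp Require Import reals.
From mathcomp Require Import polyorder polyrcf.
From mathcomp Require Import boolp classical_sets topology normedtype realfun.
From mathcomp Require Import ring lra.
Import Order.TTheory GRing.Theory Num.Theory.
Local Open Scope ring_scope.

Set Implicit Arguments.
Unset Strict Implicit.
Unset Printing Implicit Defensive.
Import numFieldNormedType.Exports.

(** The bound comes from a family of placements that degenerates.  Put the two
    sides of K_{3,3} at u_i = X_i + e t_i and v_j = X_j, where X_0, X_1, X_2 is
    a triangle and t_0, t_1, t_2 are unit vectors.  As e tends to 0 the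
    direction of u_i v_j tends to that of X_i - X_j when i <> j, and that of
    u_i v_i is t_i (collapse_directions).  So the supremum dominates what is computed from the limit
    directions, although the limit placement itself puts u_i on v_i.

    Write A for the rigidity matrix.  The nonzero eigenvalues of A A^T are those
    of the 9 x 9 matrix A^T A, and A A^T, of order 12, has three more zeros
    (char_poly_mulmxC).  Hence an estimate |A w|^2 >= nu |w|^2 with nu > 0 over
    all edge weights w gives that the fourth eigenvalue of A A^T is at least nu
    (kth_eigenvalue_ge).  The quantity |A w|^2 is Lipschitz in the directions
    (energy_perturb), so it is enough to have |A w|^2 >= 2 (1 - lam) |w|^2 for
    the limit directions (limit_energy_ge).

    The triangle is isosceles, with unit legs and with base angle of cosine
    c = sqrt lam and sine s = sqrt (1 - lam); t_0 lies on the axis, and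
    t_1 = (x, y) and t_2 = (-x, y) are mirror images.  Let w_ij be the weight of
    u_i v_j.  Since u_i v_j and u_j v_i have opposite limit directions for
    i <> j, the form |A w|^2 splits into a part in the sums w_ij + w_ji and a part
    in the differences w_ij - w_ji and the w_ii.  The first is the stiffness of a triangle, whose least
    eigenvalue is 2 s^2 = 2 (1 - lam).  The second splits under the mirror
    symmetry of the triangle; with m = s y - c x, the product of t_1 with the
    direction of the leg at X_1, the mirror-even part is singular at 2 (1 - lam)
    when m^2 = 3 lam - 2, and the mirror-odd part when
    (c lam + x m)^2 = (lam^2 - x^2) (4 lam^2 - lam - m^2).
    Eliminating x and y from these two equations and from x^2 + y^2 = 1 leaves
    the quartic of which lam is a root (optimal_directions_ex). *)

(** * Eigenvalues of a Gram matrix *)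

(** Both characteristic polynomials come from the determinant of the block matrix
    [[X, A], [B, 1]]: multiply it on the right by a unitriangular matrix that
    clears B, or by a triangular one that clears A at the price of a factor X in
    each of the last n columns. *)
Lemma char_poly_mulmxC (R : comNzRingType) m n (A : 'M[R]_(m, n))
    (B : 'M[R]_(n, m)) :
  'X^n * char_poly (A *m B) = 'X^m * char_poly (B *m A).
Proof.
rewrite /char_poly /char_poly_mx !map_mxM.
set a := map_mx polyC A; set b := map_mx polyC B.
pose M := block_mx ('X%:M : 'M_m) a b (1%:M : 'M_n).
have <- : \det M = \det ('X%:M - a *m b).
  have /(congr1 determinant) : M *m block_mx 1%:M 0 (- b) 1%:M
      = block_mx ('X%:M - a *m b) a 0 1%:M.
    rewrite mulmx_block !mulmx1 !mulmx0 !mul1mx mulmxN !add0r.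
    by rewrite subrr.
  by rewrite det_mulmx det_lblock det_ublock !det1 !mulr1.
have /(congr1 determinant) : M *m block_mx 1%:M (- a) 0 'X%:M
    = block_mx 'X%:M 0 b ('X%:M - b *m a).
  rewrite mulmx_block !mulmx1 !mulmx0 !mulmxN !mul1mx !addr0.
  by rewrite mul_scalar_mx mul_mx_scalar addNr addrC.
by rewrite det_mulmx det_ublock det_lblock det1 !det_scalar mul1r mulrC => ->.
Qed.

Section Eigenvalues.
Variable R : realType.

Lemma count_eigenvalues n (M : 'M[R]_n) x :
  count_mem x (eigenvalues M) = \mu_x (char_poly M).
Proof.
have p0 : char_poly M != 0 by rewrite monic_neq0 ?char_poly_monic.
rewrite /eigenvalues count_flatten -map_comp.
have [rx|nrx] := boolP (root (char_poly M) x); last first.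
  rewrite (muNroot nrx) sumnE big_map big1_seq // => y /andP[_ yr] /=.
  rewrite count_nseq /=; case: eqVneq => // yx; move: nrx; rewrite -yx.
  by have := roots_on_rootsR p0 y; rewrite yr inE /= => ->.
have xr : x \in rootsR (char_poly M).
  by rewrite -(roots_on_rootsR p0) inE /= rx.
have us : uniq (rootsR (char_poly M)) by apply: uniq_roots.
rewrite sumnE big_map (bigD1_seq x) //= count_nseq /= eqxx mul1n.
by rewrite big1 ?addn0 // => y /negPf yx; rewrite count_nseq /= yx.
Qed.

(** The nonzero entry keeps the index within range: the default value 0 would
    falsify the conclusion. *)
Lemma nth_sorted_gap (s : seq R) (nu : R) :
  sorted <=%R s -> 0 < nu -> {in s, forall x, x = 0 \/ nu <= x} ->
  (exists2 x, x \in s & x != 0) -> nu <= nth 0 s (count_mem 0 s).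
Proof.
move=> ss nu0 sP [x xs x0]; set k := count_mem 0 s.
have ks : (k < size s)%N.
  rewrite ltn_neqAle count_size andbT -all_count.
  by apply/negP => /allP /(_ _ xs); apply/negP.
case: (sP (nth 0 s k)) => //; first exact: mem_nth.
move=> sk0; suff : (k < k)%N by rewrite ltnn.
have : (count_mem 0%R (take k.+1 s) <= k)%N.
  have kE : k = count_mem 0 (take k.+1 s ++ drop k.+1 s) by rewrite cat_take_drop.
  by rewrite [leqRHS]kE count_cat leq_addr.
suff /eqP-> : count_mem 0 (take k.+1 s) == size (take k.+1 s).
  by rewrite size_takel.
rewrite -all_count; apply/(all_nthP 0) => i; rewrite size_takel // ltnS => ik.
rewrite nth_take //= ; apply/eqP.
have is_ : (i < size s)%N by apply: leq_ltn_trans ks.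
case: (sP (nth 0 s i)) => //; first exact: mem_nth.
move=> nui.
have : nth 0 s i <= nth 0 s k by apply: (sorted_leq_nth le_trans le_refl).
by rewrite sk0 => /(le_trans nui); rewrite leNgt nu0.
Qed.

Lemma dot_trmx n (u v : 'cV[R]_n) : (u^T *m v) 0 0 = \sum_i u i 0 * v i 0.
Proof. by rewrite mxE; apply: eq_bigr => i _; rewrite mxE. Qed.

Lemma sum_sqr_gt0 n (v : 'cV[R]_n) : v != 0 -> 0 < \sum_i v i 0 ^+ 2.
Proof.
move=> v0; rewrite lt0r sumr_ge0 ?andbT; last by move=> i _; exact: sqr_ge0.
apply: contra v0 => /eqP/psumr_eq0P v0; apply/eqP/matrixP => i j.
rewrite ord1 mxE; apply/eqP; rewrite -sqrf_eq0; apply/eqP/v0 => // k _.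
exact: sqr_ge0.
Qed.

Lemma gram_eigenvalue_ge m n (A : 'M[R]_(m, n)) (nu x : R) :
  (forall w : 'cV_n, nu * \sum_i w i 0 ^+ 2 <= \sum_i (A *m w) i 0 ^+ 2) ->
  eigenvalue (A^T *m A) x -> nu <= x.
Proof.
move=> Anu /eigenvalueP[v vx v0].
have vT0 : v^T != 0 by apply: contra v0 => /eqP v0; rewrite -[v]trmxK v0 trmx0.
rewrite -(ler_pM2r (sum_sqr_gt0 vT0)); apply: le_trans (Anu v^T) _.
suff -> : \sum_i (A *m v^T) i 0 ^+ 2 = x * \sum_i v^T i 0 ^+ 2 by [].
transitivity (((A *m v^T)^T *m (A *m v^T)) 0 0).
  by rewrite dot_trmx; apply: eq_bigr => i _.
rewrite trmx_mul trmxK mulmxA -(mulmxA v) vx -scalemxAl mxE; congr (_ * _).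
by rewrite -{1}[v]trmxK dot_trmx.
Qed.

(** The hypothesis makes A^T A positive definite, so that 0 is a root of the
    characteristic polynomial of A A^T of multiplicity exactly m, and all other
    roots are at least nu.  Oddness of n replaces the spectral theorem: it makes
    the characteristic polynomial of A^T A have a real root, so that the list of
    eigenvalues of A A^T does have more than m entries. *)
Lemma kth_eigenvalue_ge p m n (A : 'M[R]_(p, n)) (nu : R) :
  p = (n + m)%N -> odd n -> 0 < nu ->
  (forall w : 'cV_n, nu * \sum_i w i 0 ^+ 2 <= \sum_i (A *m w) i 0 ^+ 2) ->
  nu <= kth_eigenvalue m.+1 (A *m A^T).
Proof.
move=> pE n_odd nu0 Anu.
have chiE := char_poly_mulmxC A A^T.
have chi0 k (M : 'M[R]_k) : char_poly M != 0.
  by rewrite monic_neq0 ?char_poly_monic.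
have rootE x : x != 0 -> eigenvalue (A *m A^T) x = eigenvalue (A^T *m A) x.
  move=> x0; have /(congr1 (fun p => root p x)) := chiE.
  rewrite !rootM !eigenvalue_root_char /root !hornerXn !expf_eq0 (negPf x0).
  by rewrite !andbF.
have count0 : count_mem 0 (eigenvalues (A *m A^T)) = m.
  rewrite count_eigenvalues; have /(congr1 (fun p => \mu_0 p)) := chiE.
  rewrite !mu_mul ?mulf_neq0 ?expf_neq0 ?polyX_eq0 //.
  have -> : \mu_0 (char_poly (A^T *m A)) = 0%N.
    apply: muNroot; rewrite -eigenvalue_root_char; apply/negP.
    by move=> /(gram_eigenvalue_ge Anu); rewrite leNgt nu0.
  have muX : \mu_0 ('X : {poly R}) = 1%N.
    by rewrite -[X in \mu_0 X]subr0 -polyC0 mu_XsubC.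
  by rewrite !mu_exp muX !mul1n addn0 [RHS]pE => /addnI.
rewrite /kth_eigenvalue /= -{1}count0; apply: nth_sorted_gap => //.
- exact: sorted_eigenvalues.
- move=> x; rewrite mem_eigenvalues; case: (eqVneq x 0); [by left | right].
  by move: H; rewrite rootE //; apply: gram_eigenvalue_ge.
- have [|x rx] := @odd_poly_root R (char_poly (A^T *m A)).
    by rewrite size_char_poly /= n_odd.
  rewrite -eigenvalue_root_char in rx.
  have x0 : x != 0 by rewrite gt_eqF // (lt_le_trans nu0) // (gram_eigenvalue_ge Anu).
  by exists x => //; rewrite mem_eigenvalues rootE.
Qed.

(** A crude bound, from which the supremum that defines the algebraic connectivity
    is that of a bounded set. *)
Lemma kth_eigenvalue_le n k (M : 'M[R]_n) :
  kth_eigenvalue k M <= \sum_i \sum_j `|M i j|.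
Proof.
set B := \sum_i _.
have B0 : 0 <= B by apply: sumr_ge0 => i _; apply: sumr_ge0.
rewrite /kth_eigenvalue; set j := k.-1.
have [js|js] := ltnP j (size (eigenvalues M)); last by rewrite nth_default.
have := mem_nth 0 js; rewrite mem_eigenvalues; move: (nth _ _ _) => x {j js k}.
move=> /eigenvalueP[v vx v0]; apply: le_trans (ler_norm x) _.
pose N := \sum_i `|v 0 i|.
have N0 : 0 < N.
  rewrite lt0r sumr_ge0 ?andbT //; apply: contra v0 => /eqP/psumr_eq0P v0.
  by apply/eqP/rowP => i; rewrite mxE; apply/eqP; rewrite -normr_eq0 v0.
rewrite -(ler_pM2r N0).
have -> : `|x| * N = \sum_j `|(v *m M) 0 j|.
  by rewrite vx mulr_sumr; apply: eq_bigr => i _; rewrite mxE normrM.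
apply: (@le_trans _ _ (\sum_j \sum_i `|v 0 i| * `|M i j|)).
  apply: ler_sum => j _; rewrite mxE; apply: le_trans (ler_norm_sum _ _ _) _.
  by apply: ler_sum => i _; rewrite normrM.
rewrite exchange_big [leRHS]mulrC mulr_suml; apply: ler_sum => i _ /=.
rewrite -mulr_sumr; apply: ler_wpM2l => //.
rewrite [leRHS](bigD1 i) //= lerDl sumr_ge0 // => l _.
exact: sumr_ge0.
Qed.

End Eigenvalues.

(** * Directions and the algebraic connectivity *)

Section Directions.
Variable R : realType.
Local Open Scope classical_set_scope.
Local Open Scope ring_scope.

(** The zero vector is sent to 0, in agreement with the convention for the
    direction between two vertices placed at the same point. *)
Definition normalize (x : 'rV[R]_2) : 'rV[R]_2 := (euclidean_norm x)^-1 *: x.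

Lemma directionE (G : simple_graph) (p : vertex G -> 'rV[R]_2) u v :
  direction p u v = normalize (p u - p v).
Proof.
by rewrite /direction; case: eqVneq => // ->; rewrite subrr /normalize scaler0.
Qed.

Lemma normalizeZ (a : R) x : 0 < a -> normalize (a *: x) = normalize x.
Proof.
move=> a0; rewrite /normalize.
have -> : euclidean_norm (a *: x) = a * euclidean_norm x.
  rewrite /euclidean_norm; under eq_bigr do rewrite mxE exprMn.
  by rewrite -mulr_sumr sqrtrM ?sqr_ge0 // sqrtr_sqr gtr0_norm.
by rewrite invfM scalerA mulrAC mulVf ?gt_eqF // mul1r.
Qed.

Lemma euclidean_normN (x : 'rV[R]_2) : euclidean_norm (- x) = euclidean_norm x.
Proof. by congr Num.sqrt; apply: eq_bigr => i _; rewrite mxE sqrrN. Qed.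

Lemma directionN (G : simple_graph) (p : vertex G -> 'rV[R]_2) u v :
  direction p v u = - direction p u v.
Proof.
by rewrite !directionE /normalize -opprB euclidean_normN scalerN.
Qed.

Lemma normalize_le1 (x : 'rV[R]_2) i :
  `|normalize x 0 i| <= 1.
Proof.
rewrite /normalize mxE normrM normfV.
have [->|n0] := eqVneq (euclidean_norm x) 0; first by rewrite normr0 invr0 mul0r.
have ng : 0 < euclidean_norm x by rewrite lt0r n0 sqrtr_ge0.
rewrite (gtr0_norm ng) mulrC ler_pdivrMr // mul1r -sqrtr_sqr ler_sqrt.
  by rewrite (bigD1 i) //= lerDl sumr_ge0 // => j _; exact: sqr_ge0.
by apply: sumr_ge0 => j _; exact: sqr_ge0.
Qed.

Lemma normalize_continuous (x z : 'rV[R]_2) k : euclidean_norm x != 0 ->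
  normalize (x + e *: z) 0 k @[e --> (0 : R)] --> normalize x 0 k.
Proof.
move=> nx.
have cvg_coord i : (x + e *: z) 0 i @[e --> (0 : R)] --> x 0 i.
  rewrite -[X in _ --> X]addr0 -[X in _ --> _ + X](mul0r (z 0 i)).
  under eq_fun do rewrite !mxE.
  by apply: cvgD; [exact: cvg_cst | apply: cvgM; [exact: cvg_id|exact: cvg_cst]].
rewrite /normalize mxE; under eq_fun do rewrite mxE.
apply: cvgM => //; apply: cvgV => //.
rewrite /euclidean_norm; apply: continuous_cvg; first exact: sqrt_continuous.
rewrite !big_ord_recl big_ord0 addr0.
under eq_fun do rewrite !big_ord_recl big_ord0 addr0.
by apply: cvgD; apply: cvgM.
Qed.

Lemma rigidity_matrix_le1 (G : simple_graph) (p : vertex G -> 'rV[R]_2) r e :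
  `|rigidity_matrix p r e| <= 1.
Proof.
rewrite mxE; case: (enum_val r) => u i; case: pickP => [v _|_].
  by rewrite directionE normalize_le1.
by rewrite normr0.
Qed.

Lemma le_algebraic_connectivity2 (G : simple_graph)
    (p : vertex G -> 'rV[R]_2) :
  kth_eigenvalue 4 (stiffness_matrix p) <= algebraic_connectivity2 R G.
Proof.
apply: ub_le_sup; last by exists p.
exists (\sum_(i < #|{: vertex G * 'I_2}|) \sum_(j < #|{: vertex G * 'I_2}|)
  #|edges G|%:R) => _ [q _ <-].
apply: le_trans (kth_eigenvalue_le _ _) _.
apply: ler_sum => i _; apply: ler_sum => j _; rewrite mxE.
apply: le_trans (ler_norm_sum _ _ _) _.
rewrite -[X in X%:R]card_ord -sumr_const; apply: ler_sum => e _.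
by rewrite [X in _ * X]mxE normrM mulr_ile1 ?rigidity_matrix_le1.
Qed.

End Directions.

(** * The rigidity matrix of a complete bipartite graph *)

Section Energy.
Variable R : realType.

(** The squared norm of the rigidity matrix applied to the edge weights W, when
    D i j is the direction of the edge between the i-th vertex of one side and the
    j-th of the other.  The direction seen from the other end is - D i j; the sign
    disappears in the square, so that one D serves both ends. *)
Definition energy m n (D : 'I_m -> 'I_n -> 'rV[R]_2) (W : 'I_m -> 'I_n -> R) :=
  \sum_i \sum_k (\sum_j W i j * D i j 0 k) ^+ 2 +
  \sum_j \sum_k (\sum_i W i j * D i j 0 k) ^+ 2.

End Energy.

Section Bipartite.
Variables m n : nat.
Local Notation K := (complete_bipartite m n).

Definition bip_edge (ij : 'I_m * 'I_n) : {set vertex K} :=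
  [set inl ij.1; inr ij.2].

Lemma bip_edge_inj : injective bip_edge.
Proof.
move=> [i j] [i' j'] /setP e; congr (_, _).
  have := e (inl i); rewrite !inE /= eqxx /= => /esym.
  by rewrite orbF => /eqP[].
have := e (inr j); rewrite !inE /= eqxx /= => /esym.
by move=> /eqP[].
Qed.

Lemma edges_bip : edges K = bip_edge @: [set: 'I_m * 'I_n].
Proof.
apply/setP => e; apply/imsetP/imsetP => [[[[i|i] [j|j]]]|[[i j] _ ->]].
- by rewrite inE.
- by move=> _ ->; exists (i, j).
- by move=> _ ->; exists (j, i); rewrite // /bip_edge finset.setUC.
- by rewrite inE.
- by exists (inl i, inr j); rewrite ?inE.
Qed.

Lemma mem_bip_edge ij : bip_edge ij \in edges K.
Proof. by rewrite edges_bip imset_f ?inE. Qed.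

Lemma card_edges_bip : #|edges K| = (m * n)%N.
Proof.
by rewrite edges_bip card_imset ?cardsT ?card_prod ?card_ord //; exact: bip_edge_inj.
Qed.

(** Weights indexed by the numbered edges become weights indexed by pairs (i, j)
    through this bijection. *)
Definition bip_column ij : 'I_#|edges K| :=
  enum_rank_in (mem_bip_edge ij) (bip_edge ij).

Lemma bip_columnK ij : enum_val (bip_column ij) = bip_edge ij.
Proof. by rewrite enum_rankK_in ?mem_bip_edge. Qed.

Lemma bip_column_bij : bijective bip_column.
Proof.
apply: inj_card_bij => [ij ij' /(congr1 enum_val)|].
  by rewrite !bip_columnK => /bip_edge_inj.
by rewrite card_prod !card_ord card_edges_bip.
Qed.

Lemma pick_bip_edge (u : vertex K) i j :
  [pick v | bip_edge (i, j) == [set u; v]] =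
  match u with
  | inl i' => if i' == i then Some (inr j) else None
  | inr j' => if j' == j then Some (inl i) else None
  end.
Proof.
case: pickP => [v /eqP/setP e|none].
  have := e (inl i); have := e (inr j); have := e u; rewrite !inE /= !eqxx /=.
  case: u e => [i'|j'] e; rewrite ?orbF => /eqP[->]; rewrite eqxx.
    by rewrite (_ : (inr j == inl i) = false) //= => /esym/eqP->.
  by move=> _; rewrite (_ : (inl i == inr j) = false) //= => /esym/eqP->.
case: u none => [i'|j'] none; case: eqP => // e.
  by have := none (inr j); rewrite e /bip_edge eqxx.
by have := none (inl i); rewrite e /bip_edge finset.setUC eqxx.
Qed.

Variables (R : realType) (p : vertex K -> 'rV[R]_2).

Lemma sum_edges_bip (F : 'I_#|edges K| -> R) :
  \sum_c F c = \sum_i \sum_j F (bip_column (i, j)).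
Proof.
rewrite (reindex bip_column); last exact/onW_bij/bip_column_bij.
by rewrite pair_big; apply: eq_bigr => -[].
Qed.

Lemma rigidity_bip_inl i k (w : 'cV[R]_#|edges K|) :
  (rigidity_matrix p *m w) (enum_rank (inl i : vertex K, k)) 0 =
  \sum_j w (bip_column (i, j)) 0 * direction p (inl i) (inr j) 0 k.
Proof.
rewrite mxE sum_edges_bip (bigD1 i) //= addrC big1 ?add0r => [|i' ni].
  apply: eq_bigr => j _.
  by rewrite mxE enum_rankK bip_columnK pick_bip_edge eqxx mulrC.
apply: big1 => j _; rewrite mxE enum_rankK bip_columnK pick_bip_edge eq_sym.
by rewrite (negPf ni) mul0r.
Qed.

Lemma rigidity_bip_inr j k (w : 'cV[R]_#|edges K|) :
  (rigidity_matrix p *m w) (enum_rank (inr j : vertex K, k)) 0 =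
  \sum_i w (bip_column (i, j)) 0 * direction p (inr j) (inl i) 0 k.
Proof.
rewrite mxE sum_edges_bip; apply: eq_bigr => i _.
rewrite (bigD1 j) //= addrC big1 ?add0r => [|j' nj].
  by rewrite mxE enum_rankK bip_columnK pick_bip_edge eqxx mulrC.
rewrite mxE enum_rankK bip_columnK pick_bip_edge eq_sym.
by rewrite (negPf nj) mul0r.
Qed.

Lemma rigidity_bip_sqr (w : 'cV[R]_#|edges K|) :
  \sum_r (rigidity_matrix p *m w) r 0 ^+ 2 =
  energy (fun i j => direction p (inl i) (inr j))
    (fun i j => w (bip_column (i, j)) 0).
Proof.
rewrite (reindex (@enum_rank _)) /=; last first.
  by apply: onW_bij; exact: enum_rank_bij.
transitivity (\sum_u \sum_k
    (rigidity_matrix p *m w) (enum_rank (u : vertex K, k)) 0 ^+ 2).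
  by rewrite pair_big; apply: eq_bigr => -[].
rewrite big_sumType /energy; congr (_ + _); apply: eq_bigr => i _.
  by apply: eq_bigr => k _; rewrite rigidity_bip_inl.
apply: eq_bigr => k _; rewrite rigidity_bip_inr -sqrrN -sumrN; congr (_ ^+ 2).
by apply: eq_bigr => j _; rewrite directionN mxE mulrN opprK.
Qed.

End Bipartite.

(** * Dependence on the directions, and collapsing placements *)

Section Collapse.
Variable R : realType.
Local Open Scope classical_set_scope.
Local Open Scope ring_scope.

Lemma sum_sqr_le n (a : 'I_n -> R) :
  (\sum_i a i) ^+ 2 <= n%:R * \sum_i a i ^+ 2.
Proof.
have -> : (\sum_i a i) ^+ 2 = \sum_i \sum_j a i * a j.
  by rewrite expr2 mulr_suml; apply: eq_bigr => i _; rewrite mulr_sumr.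
have -> : n%:R * \sum_i a i ^+ 2 = \sum_i \sum_j (a i ^+ 2 + a j ^+ 2) / 2.
  have sumn (F : R) : \sum_(i < n) F = n%:R * F.
    by rewrite sumr_const card_ord mulr_natl.
  transitivity (\sum_i (n%:R * a i ^+ 2 + \sum_j a j ^+ 2) / 2).
    by rewrite -mulr_suml big_split /= -mulr_sumr sumn; field.
  by apply: eq_bigr => i _; rewrite -mulr_suml big_split /= sumn.
apply: ler_sum => i _; apply: ler_sum => j _.
by rewrite ler_pdivlMr // -subr_ge0; have := sqr_ge0 (a i - a j); lra.
Qed.

Lemma sqr_sum_perturb n (a b w : 'I_n -> R) eta :
  (forall j, `|a j| <= 1) -> (forall j, `|b j| <= 1) ->
  (forall j, `|b j - a j| <= eta) -> 0 <= eta ->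
  (\sum_j w j * a j) ^+ 2 - 2 * n%:R * eta * \sum_j w j ^+ 2 <=
  (\sum_j w j * b j) ^+ 2.
Proof.
move=> a1 b1 ab eta0; set S := \sum_j `|w j|.
have S2 : S ^+ 2 <= n%:R * \sum_j w j ^+ 2.
  apply: le_trans (sum_sqr_le _) _; rewrite ler_wpM2l //.
  by apply: ler_sum => j _; rewrite real_normK ?num_real.
have wle (c : 'I_n -> R) e : (forall j, `|c j| <= e) -> `|\sum_j w j * c j| <= S * e.
  move=> ce; apply: le_trans (ler_norm_sum _ _ _) _; rewrite mulr_suml.
  by apply: ler_sum => j _; rewrite normrM ler_wpM2l.
have dle : `|\sum_j w j * b j - \sum_j w j * a j| <= S * eta.
  by rewrite -sumrB; under eq_bigr do rewrite -mulrBr; exact: wle.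
have sle : `|\sum_j w j * b j + \sum_j w j * a j| <= S * 2.
  rewrite -big_split /=; under eq_bigr do rewrite -mulrDr; apply: wle => j.
  by apply: le_trans (ler_normD _ _) _; rewrite -[leRHS]/(1 + 1) lerD.
have : `|(\sum_j w j * b j - \sum_j w j * a j)
    * (\sum_j w j * b j + \sum_j w j * a j)| <= S * eta * (S * 2).
  by rewrite normrM ler_pM.
rewrite -subr_sqr ler_norml => /andP[h _].
have : 2 * eta * S ^+ 2 <= 2 * eta * (n%:R * \sum_j w j ^+ 2).
  by rewrite ler_wpM2l // mulr_ge0.
lra.
Qed.

(** By the Cauchy-Schwarz inequality each coordinate of the force at a vertex of
    degree n loses 2 n eta times the squared weights at that vertex; there are two
    coordinates, and every edge has one end of degree n and one of degree m. *)
Lemma energy_perturb m n (D D' : 'I_m -> 'I_n -> 'rV[R]_2) W eta :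
  (forall i j k, `|D i j 0 k| <= 1) -> (forall i j k, `|D' i j 0 k| <= 1) ->
  (forall i j k, `|D' i j 0 k - D i j 0 k| <= eta) -> 0 <= eta ->
  energy D W - 4 * (m + n)%:R * eta * (\sum_i \sum_j W i j ^+ 2) <=
  energy D' W.
Proof.
move=> D1 D1' DD' eta0.
have rowP l (w : 'I_l -> R) (a b : 'I_l -> 'rV[R]_2) :
    (forall j k, `|a j 0 k| <= 1) -> (forall j k, `|b j 0 k| <= 1) ->
    (forall j k, `|b j 0 k - a j 0 k| <= eta) ->
    \sum_k (\sum_j w j * a j 0 k) ^+ 2 - 4 * l%:R * eta * \sum_j w j ^+ 2 <=
    \sum_k (\sum_j w j * b j 0 k) ^+ 2.
  move=> a1 b1 ab; rewrite !big_ord_recl !big_ord0 !addr0.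
  have h k : (\sum_j w j * a j 0 k) ^+ 2 - 2 * l%:R * eta * \sum_j w j ^+ 2 <=
    (\sum_j w j * b j 0 k) ^+ 2 by apply: sqr_sum_perturb.
  by have := h ord0; have := h (lift ord0 ord0); lra.
have -> : 4 * (m + n)%:R * eta * (\sum_i \sum_j W i j ^+ 2) =
    \sum_i 4 * n%:R * eta * (\sum_j W i j ^+ 2) +
    \sum_j 4 * m%:R * eta * (\sum_i W i j ^+ 2).
  by rewrite -!mulr_sumr natrD [X in _ + _ * X]exchange_big /=; ring.
rewrite /energy opprD addrACA -!sumrB.
by apply: lerD; apply: ler_sum => i _; apply: rowP.
Qed.

Definition limit_direction n (X t : 'I_n -> 'rV[R]_2) i j : 'rV[R]_2 :=
  normalize (if i == j then t i else X i - X j).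

(** The direction from X_i + e t_i to X_i is that of t_i for every e > 0, whereas
    from X_i + e t_i to X_j it tends to that of X_i - X_j. *)
Lemma collapse_directions n (X t : 'I_n -> 'rV[R]_2) (eta : R) : 0 < eta ->
  (forall i j, i != j -> euclidean_norm (X i - X j) != 0) ->
  exists p : vertex (complete_bipartite n n) -> 'rV[R]_2, forall i j k,
    `|direction p (inl i) (inr j) 0 k - limit_direction X t i j 0 k| < eta.
Proof.
move=> eta0 X_neq.
pose p (e : R) (u : 'I_n + 'I_n) :=
  match u with inl i => X i + e *: t i | inr j => X j end.
have right0 : ProperFilter (nbhs (0 : R)^'+) by exact: at_right_proper_filter.
suff near0 : \forall e \near (0 : R)^'+, forall ijk : 'I_n * 'I_n * 'I_2,
    `|direction (G := complete_bipartite n n) (p e)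
        (inl ijk.1.1) (inr ijk.1.2) 0 ijk.2 -
      limit_direction X t ijk.1.1 ijk.1.2 0 ijk.2| < eta.
  have [e He] := filter_ex near0.
  by exists (p e) => i j k; have := He (i, j, k).
apply: filter_forall => -[[i j] k] /=.
rewrite /limit_direction; case: eqVneq => [<-|ij].
  have := nbhs_right_gt (0 : R); apply: filterS => e e0.
  by rewrite directionE /= addrAC subrr add0r normalizeZ // subrr normr0.
have := cvg_at_right_filter (@normalize_continuous R (X i - X j) (t i) k (X_neq _ _ ij)).
move=> /cvgr_distC_lt/(_ eta eta0); apply: filterS => e.
by rewrite directionE /= addrAC.
Qed.

End Collapse.

(** * The energy of the degenerate triangle *)

Section Triangle.
Variable R : realType.

Definition vec2 (a b : R) : 'rV[R]_2 := \row_k (if k == 0 then a else b).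

Lemma normalize_vec2 a b r : 0 < r -> a ^+ 2 + b ^+ 2 = r ^+ 2 ->
  normalize (vec2 a b) = vec2 (a / r) (b / r).
Proof.
move=> r0 ab; have -> : normalize (vec2 a b) = r^-1 *: vec2 a b.
  rewrite /normalize /euclidean_norm !big_ord_recl big_ord0 addr0 !mxE /=.
  by rewrite ab sqrtr_sqr gtr0_norm.
by apply/rowP => k; rewrite !mxE; case: ifP; rewrite mulrC.
Qed.

Lemma vec2B a b a' b' : vec2 a b - vec2 a' b' = vec2 (a - a') (b - b').
Proof. by apply/rowP => k; rewrite !mxE; case: ifP. Qed.

Lemma euclidean_norm_vec2_neq0 a b : a != 0 -> euclidean_norm (vec2 a b) != 0.
Proof.
move=> a0; rewrite /euclidean_norm !big_ord_recl big_ord0 addr0 !mxE /=.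
by rewrite gt_eqF // sqrtr_gt0 ltr_pwDl ?sqr_ge0 // exprn_even_gt0.
Qed.

Definition triangle (c s : R) (i : 'I_3) : 'rV[R]_2 :=
  nth 0 [:: vec2 0 s; vec2 c 0; vec2 (- c) 0] i.

(** The limit directions of the edges u_i v_i. *)
Definition rungs (x y : R) (i : 'I_3) : 'rV[R]_2 :=
  nth 0 [:: vec2 0 1; vec2 x y; vec2 (- x) y] i.

Lemma triangle_neq c s i j : 0 < c -> i != j ->
  euclidean_norm (triangle c s i - triangle c s j) != 0.
Proof.
move=> c0; have cc0 : c + c != 0 by rewrite gt_eqF ?addr_gt0.
case: i j => [[|[|[|//]]] ?] [[|[|[|//]]] ?] //= _; rewrite /triangle /= vec2B.
all: apply: euclidean_norm_vec2_neq0.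
all: by rewrite ?sub0r ?subr0 ?opprK -?opprD ?oppr_eq0 // gt_eqF.
Qed.

Lemma binary_form_ge0 (a b d u v : R) :
  0 < a -> b ^+ 2 <= a * d -> 0 <= a * u ^+ 2 + 2 * b * u * v + d * v ^+ 2.
Proof.
move=> a0 h; rewrite -(pmulr_rge0 _ a0).
have -> : a * (a * u ^+ 2 + 2 * b * u * v + d * v ^+ 2)
  = (a * u + b * v) ^+ 2 + (a * d - b ^+ 2) * v ^+ 2 by ring.
by rewrite addr_ge0 ?sqr_ge0 // mulr_ge0 ?sqr_ge0 // subr_ge0.
Qed.

(** The stiffness of the triangle alone: p and q weigh the legs and g the base.
    The difference of the two sides vanishes for weights p = q with p + c g = 0,
    so that 2 (1 - lam) is the least eigenvalue of this part. *)
Lemma symmetric_form_ge (lam c s p q g : R) : 1 / 2 < lam ->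
  c ^+ 2 = lam -> s ^+ 2 = 1 - lam ->
  2 * (1 - lam) * (p ^+ 2 + q ^+ 2 + g ^+ 2) <=
  (- c * p + c * q) ^+ 2 + (s * p + s * q) ^+ 2 +
  (c * p + g) ^+ 2 + (s * p) ^+ 2 + (c * q + g) ^+ 2 + (s * q) ^+ 2.
Proof.
move=> l2 c2 s2; rewrite -subr_ge0.
have -> : (- c * p + c * q) ^+ 2 + (s * p + s * q) ^+ 2 +
  (c * p + g) ^+ 2 + (s * p) ^+ 2 + (c * q + g) ^+ 2 + (s * q) ^+ 2
  - 2 * (1 - lam) * (p ^+ 2 + q ^+ 2 + g ^+ 2)
  = ((p + q) + 2 * c * g) ^+ 2 / 2 + (2 * lam - 1 / 2) * (p - q) ^+ 2
    + (s ^+ 2 - (1 - c ^+ 2)) * ((p + q) ^+ 2 + p ^+ 2 + q ^+ 2).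
  by rewrite -c2; field.
rewrite c2 s2 subrr mul0r addr0 addr_ge0 ?divr_ge0 ?sqr_ge0 //.
by rewrite mulr_ge0 ?sqr_ge0 //; lra.
Qed.

(** The part that is odd under the exchange of the two copies of the triangle.
    Complete squares to eliminate a0, a1 + a2 and a1 - a2.  The mirror-even
    remainder, a multiple of (p + q)^2, vanishes since m^2 = 3 lam - 2; the
    mirror-odd remainder is the binary form in g and p - q named form, whose
    discriminant condition is the last hypothesis. *)
Lemma antisymmetric_form_ge (lam c s x y m a0 a1 a2 p q g : R) : 0 < lam ->
  c ^+ 2 = lam -> s ^+ 2 = 1 - lam -> x ^+ 2 + y ^+ 2 = 1 ->
  m = s * y - c * x -> m ^+ 2 = 3 * lam - 2 -> x ^+ 2 < lam ^+ 2 ->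
  (c * lam + x * m) ^+ 2 <=
    (lam ^+ 2 - x ^+ 2) * (4 * lam ^+ 2 - lam - m ^+ 2) ->
  2 * (1 - lam) *
    ((a0 ^+ 2 + a1 ^+ 2 + a2 ^+ 2) / 2 + p ^+ 2 + q ^+ 2 + g ^+ 2) <=
  (- c * p + c * q) ^+ 2 + (a0 + s * p + s * q) ^+ 2 +
  (x * a1 + g - c * p) ^+ 2 + (y * a1 + s * p) ^+ 2 +
  (- x * a2 + g + c * q) ^+ 2 + (y * a2 + s * q) ^+ 2.
Proof.
move=> l0 c2 s2 y2 mE m2 xl disc; rewrite -subr_ge0.
set form := 4 * (lam ^+ 2 - x ^+ 2) * g ^+ 2
  + 2 * (- 2 * (c * lam + x * m)) * g * (p - q)
  + (4 * lam ^+ 2 - lam - m ^+ 2) * (p - q) ^+ 2.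
have form0 : 0 <= form.
  apply: binary_form_ge0; first by rewrite mulr_gt0 ?subr_gt0.
  have -> : (- 2 * (c * lam + x * m)) ^+ 2 = 4 * (c * lam + x * m) ^+ 2 by ring.
  by rewrite -[leRHS]mulrA ler_wpM2l.
have -> : (- c * p + c * q) ^+ 2 + (a0 + s * p + s * q) ^+ 2 +
  (x * a1 + g - c * p) ^+ 2 + (y * a1 + s * p) ^+ 2 +
  (- x * a2 + g + c * q) ^+ 2 + (y * a2 + s * q) ^+ 2
  - 2 * (1 - lam) *
    ((a0 ^+ 2 + a1 ^+ 2 + a2 ^+ 2) / 2 + p ^+ 2 + q ^+ 2 + g ^+ 2)
  = (lam * a0 + s * (p + q)) ^+ 2 / lam
  + (lam * (a1 + a2) + m * (p + q)) ^+ 2 / (2 * lam)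
  + ((lam * (a1 - a2) + 2 * x * g + m * (p - q)) ^+ 2 + form) / (2 * lam)
  + (s ^+ 2 - (1 - lam)) * ((p + q) ^+ 2 * (1 - lam^-1) + p ^+ 2 + q ^+ 2)
  + (x ^+ 2 + y ^+ 2 - 1) * (a1 ^+ 2 + a2 ^+ 2)
  - (m ^+ 2 - (3 * lam - 2)) * (p + q) ^+ 2 / (2 * lam).
  move: l0; rewrite /form mE -c2 => l0.
  have c0 : c != 0 by apply: contraTneq l0 => ->; rewrite expr0n ltxx.
  by field.
rewrite s2 y2 m2 !subrr !mul0r !addr0 subr0.
have l20 : 0 <= 2 * lam by rewrite mulr_ge0 // ltW.
apply: addr_ge0; last by rewrite divr_ge0 // addr_ge0 ?sqr_ge0.
by apply: addr_ge0; rewrite divr_ge0 ?sqr_ge0 // ltW.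
Qed.

(** The forms of symmetric_form_ge and antisymmetric_form_ge are evaluated at
    w_ij + w_ji, and at w_ij - w_ji and 2 w_ii: adding or subtracting the forces
    at u_i and v_i leaves only these combinations, because the direction of
    X_i - X_j is odd in (i, j) and t_i is common to both. *)
Lemma limit_energy_ge (lam c s x y m : R) (W : 'I_3 -> 'I_3 -> R) :
  1 / 2 < lam ->
  0 < c -> c ^+ 2 = lam -> s ^+ 2 = 1 - lam -> x ^+ 2 + y ^+ 2 = 1 ->
  m = s * y - c * x -> m ^+ 2 = 3 * lam - 2 -> x ^+ 2 < lam ^+ 2 ->
  (c * lam + x * m) ^+ 2 <=
    (lam ^+ 2 - x ^+ 2) * (4 * lam ^+ 2 - lam - m ^+ 2) ->
  2 * (1 - lam) * (\sum_i \sum_j W i j ^+ 2) <=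
  energy (limit_direction (triangle c s) (rungs x y)) W.
Proof.
move=> l2 c0 c2 s2 y2 mE m2 xl disc; rewrite /energy /limit_direction /triangle /rungs.
rewrite !big_ord_recl !big_ord0 /= !addr0 !vec2B !sub0r !subr0 !opprK oppr0.
have cs1 : c ^+ 2 + s ^+ 2 = 1 by rewrite c2 s2 addrC subrK.
have c20 : 0 < c + c by rewrite addr_gt0.
have unit a b : a ^+ 2 + b ^+ 2 = 1 -> normalize (vec2 a b) = vec2 a b.
  by move=> ab; rewrite (@normalize_vec2 _ _ 1) ?divr1 // expr1n.
rewrite (unit 0 1) ?expr0n ?expr1n ?add0r //.
rewrite (unit x y) // (unit (- x) y) ?sqrrN //.
rewrite (unit c s) // !(unit (- c), unit c) ?sqrrN //.
rewrite (@normalize_vec2 (c + c) 0 (c + c)) ?expr0n ?addr0 //.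
rewrite (@normalize_vec2 (- c - c) 0 (c + c)) ?expr0n ?addr0 //; last first.
  by rewrite -opprD sqrrN.
rewrite -opprD mulNr divff ?gt_eqF // mul0r !mxE /=.
move: (W ord0 ord0) => w00.
move: (W ord0 (lift ord0 ord0)) => w01.
move: (W ord0 (lift ord0 (lift ord0 ord0))) => w02.
move: (W (lift ord0 ord0) ord0) => w10.
move: (W (lift ord0 ord0) (lift ord0 ord0)) => w11.
move: (W (lift ord0 ord0) (lift ord0 (lift ord0 ord0))) => w12.
move: (W (lift ord0 (lift ord0 ord0)) ord0) => w20.
move: (W (lift ord0 (lift ord0 ord0)) (lift ord0 ord0)) => w21.
move: (W (lift ord0 (lift ord0 ord0)) (lift ord0 (lift ord0 ord0))) => w22.
(* Twice the energy is the sum of the two forms, since the squared sums at the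
   two copies of a vertex satisfy 2 (u^2 + v^2) = (u + v)^2 + (u - v)^2. *)
have := symmetric_form_ge (w01 + w10) (w02 + w20) (w12 + w21) l2 c2 s2.
have l0 : 0 < lam by lra.
have := antisymmetric_form_ge (2 * w00) (2 * w11) (2 * w22) (w01 - w10)
  (w02 - w20) (w12 - w21) l0 c2 s2 y2 mE m2 xl disc.
clear.
lra.
Qed.

End Triangle.

(** * The quartic and the optimal parameters *)

Section Quartic.
Variable R : realType.

Lemma horner_lambda_poly (x : R) : (lambda_poly R).[x] =
  176 * x ^+ 4 - 200 * x ^+ 3 + 47 * x ^+ 2 + 18 * x - 9.
Proof. by rewrite /lambda_poly !hornerE. Qed.

(** The quotient of the difference of the values at y and x by y - x is a cubic in
    y which is positive on the positive axis. *)
Lemma lambda_poly_root_uniq (x y : R) : 69 / 100 < x < 70 / 100 -> 0 < y ->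
  root (lambda_poly R) x -> root (lambda_poly R) y -> y = x.
Proof.
rewrite /root !horner_lambda_poly => /andP[x1 x2] y0 /eqP fx /eqP fy.
apply/eqP; rewrite -subr_eq0; apply/eqP.
have : (y - x) * (176 * (y ^+ 3 + y ^+ 2 * x + y * x ^+ 2 + x ^+ 3)
   - 200 * (y ^+ 2 + y * x + x ^+ 2) + 47 * (y + x) + 18) = 0.
  by rewrite -[RHS](subrr 0) -{1}fy -fx; ring.
move=> /eqP; rewrite mulf_eq0 => /orP[/eqP//|/eqP q0]; exfalso.
have a2 : -79 <= 176 * x - 200 by lra.
have a1 : -8 <= 176 * x ^+ 2 - 200 * x + 47 by nra.
have a0 : 12 <= 176 * x ^+ 3 - 200 * x ^+ 2 + 47 * x + 18 by nra.
have h2 : 0 <= (176 * x - 200 + 79) * y ^+ 2 by rewrite mulr_ge0 ?sqr_ge0; lra.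
have h1 : 0 <= (176 * x ^+ 2 - 200 * x + 47 + 8) * y by rewrite mulr_ge0; lra.
(* With the bounds a2 and a1, the cubic without its constant term is, for y > 0,
   least near y = 35/100; h3 certifies that it stays above -12. *)
have h3 : 0 <= (y - 35 / 100) ^+ 2 * (y + 1 / 4) by rewrite mulr_ge0 ?sqr_ge0; lra.
nra.
Qed.

Lemma lambda_poly_root_ex : exists2 lam : R,
  690 / 10 ^+ 3 + 3845 / 10 ^+ 7 < lam < 690 / 10 ^+ 3 + 3846 / 10 ^+ 7 &
  root (lambda_poly R) lam.
Proof.
have [||lam] := @poly_ivtoo R (lambda_poly R)
  (690 / 10 ^+ 3 + 3845 / 10 ^+ 7) (690 / 10 ^+ 3 + 3846 / 10 ^+ 7).
- by lra.
- by rewrite !horner_lambda_poly pmulr_llt0; lra.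
- by rewrite in_itv /=; exists lam.
Qed.

(** These c, s, x, y make the three parts of the energy (symmetric, mirror-even
    antisymmetric, mirror-odd antisymmetric) all singular at 2 (1 - lam). *)
Lemma optimal_directions_ex (lam : R) :
  69 / 100 < lam < 70 / 100 -> root (lambda_poly R) lam ->
  exists c s x y m : R,
    [/\ 0 < c, c ^+ 2 = lam, s ^+ 2 = 1 - lam & x ^+ 2 + y ^+ 2 = 1] /\
    [/\ m = s * y - c * x, m ^+ 2 = 3 * lam - 2, x ^+ 2 < lam ^+ 2 &
      (c * lam + x * m) ^+ 2 <=
        (lam ^+ 2 - x ^+ 2) * (4 * lam ^+ 2 - lam - m ^+ 2)].
Proof.
rewrite /root horner_lambda_poly => /andP[l1 l2] /eqP lam_root.
pose c := Num.sqrt lam; pose s := Num.sqrt (1 - lam); pose r := Num.sqrt 3 : R.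
have c2 : c ^+ 2 = lam by rewrite sqr_sqrtr //; lra.
have s2 : s ^+ 2 = 1 - lam by rewrite sqr_sqrtr //; lra.
have r2 : r ^+ 2 = 3 by rewrite sqr_sqrtr //; lra.
have c0 : 0 < c by rewrite sqrtr_gt0; lra.
have s0 : 0 < s by rewrite sqrtr_gt0; lra.
have d0 : 2 * lam - 1 != 0 by rewrite gt_eqF //; lra.
(* The three equations give x two ways: x^2 is a rational function of lam (x2),
   and x is a root of X^2 - 2 r (1 - lam) X + 3 - 4 lam (rx).  Substituting the
   first into the second gives the value of x below, and the quartic is the
   condition that the two agree. *)
pose x := r * (17 * lam - 4 * lam ^+ 2 - 9) / (12 * (2 * lam - 1)).
have x2 : (4 * lam - 2) * x ^+ 2 =
    4 * lam ^+ 3 - 5 * lam ^+ 2 + 6 * lam - 3.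
  rewrite /x !exprMn r2; apply/eqP; rewrite -subr_eq0; apply/eqP.
  transitivity (- (176 * lam ^+ 4 - 200 * lam ^+ 3 + 47 * lam ^+ 2 + 18 * lam - 9)
      / (24 * (2 * lam - 1))); first by field.
  by rewrite lam_root oppr0 mul0r.
have rx : 2 * (1 - lam) * r * x = x ^+ 2 + 3 - 4 * lam.
  apply: (mulfI d0); apply: (mulfI (_ : 2 != 0 :> R)); first by rewrite pnatr_eq0.
  transitivity ((1 - lam) * r ^+ 2 * (17 * lam - 4 * lam ^+ 2 - 9) / 3).
    by rewrite /x; field.
  rewrite r2; transitivity ((4 * lam - 2) * x ^+ 2 + (4 * lam - 2) * (3 - 4 * lam)).
    by rewrite x2; field.
  by ring.
pose h := r * (1 - lam) - x.
have hx : 2 * h * x = 3 - 4 * lam - x ^+ 2.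
  transitivity (2 * (1 - lam) * r * x - 2 * x ^+ 2); first by rewrite /h; ring.
  by rewrite rx; ring.
have h2 : h ^+ 2 = lam * (3 * lam - 2).
  transitivity (r ^+ 2 * (1 - lam) ^+ 2 - 2 * (1 - lam) * r * x + x ^+ 2).
    by rewrite /h; ring.
  by rewrite r2 rx; ring.
pose m := h / c; pose y := (m + c * x) / s.
have cm : c * m = h by rewrite /m mulrC divfK // gt_eqF.
have m2 : m ^+ 2 = 3 * lam - 2.
  by rewrite /m expr_div_n h2 c2 mulrC mulKf // gt_eqF //; lra.
have sy : s * y = m + c * x by rewrite /y mulrC divfK // gt_eqF.
exists c, s, x, y, m; split; split=> //.
- have s20 : s ^+ 2 != 0 by rewrite expf_neq0 // gt_eqF.
  apply: (mulfI s20); rewrite mulrDr -[X in _ + X]exprMn sy mulr1.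
  transitivity (s ^+ 2 * x ^+ 2 + m ^+ 2 + 2 * (c * m) * x + c ^+ 2 * x ^+ 2).
    by ring.
  by rewrite cm hx m2 s2 c2; ring.
- by rewrite sy addrK.
- have d1 : 0 < 4 * lam - 2 by lra.
  rewrite -(ltr_pM2l d1) x2 -subr_gt0.
  have -> : (4 * lam - 2) * lam ^+ 2
     - (4 * lam ^+ 3 - 5 * lam ^+ 2 + 6 * lam - 3) = 3 * (1 - lam) ^+ 2 by ring.
  by rewrite mulr_gt0 // exprn_gt0 //; lra.
- rewrite -subr_ge0 m2.
  have -> : (c * lam + x * m) ^+ 2
    = c ^+ 2 * lam ^+ 2 + lam * (2 * (c * m) * x) + m ^+ 2 * x ^+ 2 by ring.
  rewrite cm hx m2 c2.
  have -> : (lam ^+ 2 - x ^+ 2) * (4 * lam ^+ 2 - lam - (3 * lam - 2)) -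
    (lam * lam ^+ 2 + lam * (3 - 4 * lam - x ^+ 2) + (3 * lam - 2) * x ^+ 2)
   = lam * (4 * lam ^+ 3 - 5 * lam ^+ 2 + 6 * lam - 3 - (4 * lam - 2) * x ^+ 2).
    by ring.
  by rewrite x2 subrr mulr0.
Qed.

End Quartic.

(** Placements close enough to the degenerate one reach 2 (1 - lam) - e' for every
    small e' > 0: directions within e' / 24 of the limit ones lose at most
    e' |w|^2, as 24 = 4 (3 + 3) is the constant of energy_perturb.  The cap e' <= 1 - lam
    keeps the estimate positive, as kth_eigenvalue_ge demands. *)
Lemma algebraic_connectivity2_K33_ge (R : realType) (lam : R) :
  69 / 100 < lam < 70 / 100 -> root (lambda_poly R) lam ->
  2 * (1 - lam) <= algebraic_connectivity2 R (complete_bipartite 3 3).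
Proof.
move=> lamI lam_root; have /andP[l1 l2] := lamI.
have [c [s [x [y [m [[c0 c2 s2 xy] [mE m2 xl disc]]]]]]] :=
  optimal_directions_ex lamI lam_root.
apply/ler_addgt0Pr => e e0; pose e' := Num.min e (1 - lam).
have e'0 : 0 < e' by rewrite lt_min e0; lra.
have e'l : e' <= 1 - lam by rewrite ge_min lexx orbT.
have eta0 : 0 < e' / 24 by rewrite divr_gt0.
have [p pP] := collapse_directions (rungs x y) eta0
  (fun i j => @triangle_neq R c s i j c0).
rewrite -lerBlDr; apply: (@le_trans _ _ (2 * (1 - lam) - e')).
  by rewrite lerD2l lerN2 ge_min lexx.
apply: le_trans (le_algebraic_connectivity2 p).
apply: kth_eigenvalue_ge.
- by rewrite card_edges_bip card_prod card_sum !card_ord.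
- by rewrite card_edges_bip.
- by lra.
move=> w; rewrite rigidity_bip_sqr sum_edges_bip.
set W := fun i j => w (bip_column (i, j)) 0.
apply: le_trans (energy_perturb (D := limit_direction (triangle c s) (rungs x y))
  (eta := e' / 24) W _ _ _ _).
- have l12 : 1 / 2 < lam by lra.
  have := limit_energy_ge W l12 c0 c2 s2 xy mE m2 xl disc.
  rewrite /W; lra.
- by move=> i j k; apply: normalize_le1.
- by move=> i j k; rewrite directionE; apply: normalize_le1.
- by move=> i j k; apply/ltW/pP.
- exact: ltW.
Qed.

Theorem theorem1p6 (R : realType) :
  exists lam : R,
    [/\ (forall x : R, (0 < x) && root (lambda_poly R) x <-> x = lam),
        `|lam - (690 / 10 ^+ 3 + 3845 / 10 ^+ 7)| < 1 / 10 ^+ 7,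
        2 * (1 - lam) <= algebraic_connectivity2 R (complete_bipartite 3 3)
      & `|2 * (1 - lam) - (619 / 10 ^+ 3 + 2309 / 10 ^+ 7)| < 1 / 10 ^+ 7].
Proof.
have [lam /andP[l1 l2] lam_root] := lambda_poly_root_ex R.
have lamI : 69 / 100 < lam < 70 / 100 by apply/andP; split; lra.
exists lam; split.
- move=> x; split=> [/andP[x0 rx]|->].
    exact: (lambda_poly_root_uniq lamI x0 lam_root rx).
  by rewrite lam_root andbT; lra.
- by rewrite ltr_norml; apply/andP; split; lra.
- exact: algebraic_connectivity2_K33_ge.
- by rewrite ltr_norml; apply/andP; split; lra.
Qed.
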